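(* Let $n\ge 1$, let $m=2d$ be an even positive integer, and let $\mathcal{F}$ be a real symmetric tensor of order $m$ and dimension $n$, with associated form $f(x)=\sum_{1\le i_1,\ldots,i_m\le n}\mathcal{F}_{i_1,\ldots,i_m}x_{i_1}\cdots x_{i_m}$. Let $g(x)=(x^Tx)^d$. Let $f_{\max}$ and $f_{\min}$ be the maximum and minimum of $f$ on the unit sphere $\mathbb{S}^{n-1}$. Let $$f_{\max}^{\mathrm{sdp}}=\max\{\langle f,y\rangle:\ y\in\mathbb{R}^{\mathbb{N}^n_m},\ M(y)\succeq 0,\ \langle g,y\rangle=1\},$$ $$f_{\min}^{\mathrm{sdp}}=\min\{\langle f,z\rangle:\ z\in\mathbb{R}^{\mathbb{N}^n_m},\ M(z)\succeq 0,\ \langle g,z\rangle=1\},$$ and let $y^*$ be a maximizer of the first problem and $z^*$ a minimizer of the second problem. Then: (i) Suppose $f_{\max}=f_{\max}^{\mathrm{sdp}}$. If $f_{\max}\cdot g-f$ is a smooth point of the boundary $\partial\Sigma_{n,m}$, then $\operatorname{rank} M(y^* )=1$. (ii) Suppose $f_{\min}=f_{\min}^{\mathrm{sdp}}$. If $f-f_{\min}\cdot g$ is a smooth point of the boundary $\partial\Sigma_{n,m}$, then $\operatorname{rank} M(z^* )=1$.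
   Context: A real tensor $\mathcal{F}=(\mathcal{F}_{i_1,\ldots,i_m})_{1\le i_1,\ldots,i_m\le n}$ is symmetric if its entries are invariant under permutations of the indices. $\mathbb{S}^{n-1}=\{x\in\mathbb{R}^n:\|x\|=1\}$. A form is a homogeneous polynomial. $\mathbb{N}$ is the set of nonnegative integers and $\mathbb{N}^n_m=\{\alpha\in\mathbb{N}^n:\alpha_1+\cdots+\alpha_n=m\}$; for $\alpha\in\mathbb{N}^n$, $x^\alpha=x_1^{\alpha_1}\cdots x_n^{\alpha_n}$. For a form $p=\sum_{\alpha\in\mathbb{N}^n_m}p_\alpha x^\alpha$ of degree $m$ and $y\in\mathbb{R}^{\mathbb{N}^n_m}$, $\langle p,y\rangle=\sum_{\alpha\in\mathbb{N}^n_m}p_\alpha y_\alpha$. Let $[x^d]$ be the column vector of all $\binom{n+d-1}{d}$ monomials of degree $d$ in $x=(x_1,\ldots,x_n)$, and let $A_\alpha$ be the constant symmetric matrices such that $[x^d][x^d]^T=\sum_{\alpha\in\mathbb{N}^n_m}A_\alpha x^\alpha$. For $y\in\mathbb{R}^{\mathbb{N}^n_m}$ define $M(y)=\sum_{\alpha\in\mathbb{N}^n_m}A_\alpha y_\alpha$ (that is, the entry of $M(y)$ in the position of monomials $x^\beta,x^\gamma$ is $y_{\beta+\gamma}$). $W\succeq 0$ means that the symmetric matrix $W$ is positive semidefinite. $\Sigma_{n,m}$ is the cone of forms of degree $m$ in $(x_1,\ldots,x_n)$ with real coefficients that are sums of squares of real polynomials, viewed as a closed convex cone in the vector space $\mathbb{R}[x]_m$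 of all real forms of degree $m$ in $x$, and $\partial\Sigma_{n,m}$ is its boundary in that space. A point $\sigma\in\partial\Sigma_{n,m}$ is a smooth point if there is a unique supporting hyperplane of $\Sigma_{n,m}$ through $\sigma$. Both semidefinite programs in the claim attain their optimal values, since their common feasible set is nonempty and compact. *)

(* Defs.v *)
From HB Require Import structures.
From mathcomp Require Import all_boot all_order all_algebra all_fingroup.
From mathcomp Require Import mpoly.
From mathcomp Require Import boolp classical_sets reals topology normedtype.

Set Implicit Arguments.
Unset Strict Implicit.
Unset Printing Implicit Defensive.

Import Order.TTheory GRing.Theory Num.Theory.
Import numFieldNormedType.Exports.

Local Open Scope classical_set_scope.
Local Open Scope ring_scope.

(* The exponents of degree exactly m, i.e. N^n_m, as a finite type. *)
Record expo (n m : nat) := Expo {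
  expo_bmnm :> 'X_{1..n < m.+1};
  _ : mdeg expo_bmnm == m }.

HB.instance Definition _ n m := [isSub for @expo_bmnm n m].
HB.instance Definition _ n m := [Finite of expo n m by <:].

Lemma expo_mdeg n m (a : expo n m) : mdeg a = m.
Proof. by case: a => a /= /eqP. Qed.

Definition mon_expo n m (i : 'I_#|{: expo n m}|) : 'X_{1..n} :=
  bmnm (expo_bmnm (enum_val i)).

(* The space R[x]_m is the library type [dhomog n R m].  The coefficient map
   is a linear bijection onto R^(N^n_m); pulling back the topology of the
   latter gives the usual topology of this finite-dimensional space.         *)

Definition coefv (R : realType) n m (p : dhomog n R m) :
    'rV[R]_#|{: expo n m}| :=
  \row_i (p : {mpoly R[n]})@_(mon_expo i).

HB.instance Definition _ (R : realType) n m :=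
  Topological.copy (dhomog n R m) (initial_topology (@coefv R n m)).

Definition boundary (T : topologicalType) (S : set T) : set T :=
  closure S `\` interior S.

(* A hyperplane is a level set of a nonzero linear functional.  All linear
   functionals are allowed: they are continuous in finite dimension.         *)
Definition supporting_hyperplane (R : realType) (V : lmodType R)
    (S : set V) (x : V) (H : set V) : Prop :=
  exists (l : {scalar V}) (c : R),
    [/\ exists v, l v != 0,
        H = [set v | l v = c],
        H x
      & forall s, S s -> c <= l s].

Definition sos_cone (R : realType) n m : set (dhomog n R m) :=
  [set p | exists qs : seq {mpoly R[n]}, val p = \sum_(q <- qs) q ^+ 2].

Definition smooth_point_sos (R : realType) n m (p : dhomog n R m) : Prop :=
  boundary (@sos_cone R n m) p /\
  exists! H : set (dhomog n R m), supporting_hyperplane (@sos_cone R n m) p H.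


Definition sym_tensor (R : realType) n m (F : m.-tuple 'I_n -> R) : Prop :=
  forall (s : 'S_m) (t : m.-tuple 'I_n),
    F [tuple tnth t (s j) | j < m] = F t.

Lemma tensor_form_subproof (R : realType) n m (F : m.-tuple 'I_n -> R) :
  \sum_(t : m.-tuple 'I_n) F t *: \prod_(j < m) ('X_(tnth t j) : {mpoly R[n]})
    \is m.-homog.
Proof.
apply: rpred_sum => t _; apply: rpredZ.
have := @dhomog_prod n R mdeg m [tuple 1%N | j < m]
  [tuple ('X_(tnth t j) : {mpoly R[n]}) | j < m].
rewrite !big_tuple.
under eq_bigr do rewrite tnth_mktuple.
under [X in (X .-homog)]eq_bigr do rewrite tnth_mktuple.
rewrite sum1_card card_ord; apply => i.
by rewrite !tnth_mktuple dhomogX; apply/eqP; exact: mdeg1.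
Qed.

Definition tensor_form (R : realType) n m (F : m.-tuple 'I_n -> R) :
  dhomog n R m := DHomog (tensor_form_subproof F).

Lemma gform_subproof (R : realType) n d :
  (\sum_(i < n) ('X_i : {mpoly R[n]}) ^+ 2) ^+ d \is (2 * d).-homog.
Proof.
apply: dhomogMn; apply: rpred_sum => i _.
by rewrite -[2%N]mul1n; apply: dhomogMn; rewrite dhomogX; apply/eqP; exact: mdeg1.
Qed.

Definition gform (R : realType) n d : dhomog n R (2 * d) :=
  DHomog (gform_subproof R n d).


(* The canonical norm of ['rV[R]_n] in the library is the max norm. *)
Definition enorm (R : realType) n (x : 'I_n -> R) : R :=
  Num.sqrt (\sum_(i < n) x i ^+ 2).

Definition sphere (R : realType) n : set ('I_n -> R) := [set x | enorm x = 1].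

Definition is_max (R : realType) (A : set R) (v : R) : Prop :=
  A v /\ ubound A v.

Definition is_min (R : realType) (A : set R) (v : R) : Prop :=
  A v /\ lbound A v.


Definition pairing (R : realType) n m (p : dhomog n R m) (y : expo n m -> R) :
  R := \sum_(a : expo n m) (p : {mpoly R[n]})@_a * y a.

Definition momA (R : realType) n d (a : expo n (2 * d)) :
    'M[R]_#|{: expo n d}| :=
  \matrix_(i, j) ((mon_expo i + mon_expo j)%MM == a :> 'X_{1..n})%:R.

Definition moment_mx (R : realType) n d (y : expo n (2 * d) -> R) :
    'M[R]_#|{: expo n d}| :=
  \sum_(a : expo n (2 * d)) y a *: momA R a.

Definition monomials (R : realType) n d : 'cV[{mpoly R[n]}]_#|{: expo n d}| :=
  \col_i 'X_[mon_expo i].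

Lemma sum_expo_eq (V : nmodType) n m (b : 'X_{1..n}) (F : 'X_{1..n} -> V) :
  mdeg b = m ->
  \sum_(a : expo n m) (F a) *+ (b == a :> 'X_{1..n}) = F b.
Proof.
move=> db; have lt_b : (mdeg b < m.+1)%N by rewrite db.
have eb : mdeg (BMultinom lt_b) == m by rewrite /= db.
rewrite (bigD1 (Expo eb)) //= eqxx mulr1n big1 ?addr0 // => a ne_a.
case: eqP => // ba; case/eqP: ne_a.
by apply/val_inj/val_inj.
Qed.

Lemma mdeg_mon_expo n m (i : 'I_#|{: expo n m}|) : mdeg (mon_expo i) = m.
Proof. exact: expo_mdeg. Qed.

(* The matrices [momA] are the ones defined by [x^d][x^d]^T. *)
Lemma monomials_mul (R : realType) n d :
  monomials R n d *m (monomials R n d)^T =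
  \sum_(a : expo n (2 * d)) 'X_[a] *: map_mx (@mpolyC n R) (momA R a).
Proof.
apply/matrixP => i j; rewrite mxE big_ord1 !mxE summxE -mpolyXD.
set b := (mon_expo i + mon_expo j)%MM.
have db : mdeg b = (2 * d)%N by rewrite mdegD !mdeg_mon_expo mul2n addnn.
rewrite -(sum_expo_eq (fun a => 'X_[R, a]) db); apply: eq_bigr => a _.
by rewrite !mxE -/b mpolyC_nat mulr_natr.
Qed.

Lemma moment_mxE (R : realType) n d (y : expo n (2 * d) -> R)
    (i j : 'I_#|{: expo n d}|) (a : expo n (2 * d)) :
  (mon_expo i + mon_expo j)%MM = a -> moment_mx y i j = y a.
Proof.
move=> eij; rewrite summxE (bigD1 a) //= big1 ?addr0 => [|b ne_ba].
  by rewrite !mxE eij eqxx mulr1.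
rewrite !mxE eij; case: eqP => [ab|]; last by rewrite mulr0.
by case/eqP: ne_ba; apply/val_inj/val_inj.
Qed.

Definition psdmx (R : realType) N (W : 'M[R]_N) : Prop :=
  W^T = W /\ forall v : 'cV[R]_N, 0 <= (v^T *m W *m v) 0 0.

Definition sdp_feasible (R : realType) n d : set (expo n (2 * d) -> R) :=
  [set y | psdmx (moment_mx y) /\ pairing (gform R n d) y = 1].

Definition maximizer (R : realType) (T : Type) (D : set T) (h : T -> R) (y : T) :
  Prop := D y /\ forall w, D w -> h w <= h y.

Definition minimizer (R : realType) (T : Type) (D : set T) (h : T -> R) (z : T) :
  Prop := D z /\ forall w, D w -> h z <= h w.

(* Main.v *)
(* Let [p] be the smooth point, i.e. [fmax g - f] or [f - fmin g].  A point [x]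
   of the sphere where [f] attains its optimum and an SDP optimizer [y] give two
   linear functionals, evaluation at [x] and the pairing with [y].  Both are
   nonnegative on sums of squares, vanish at [p] and take the value 1 at [g].
   Their kernels are supporting hyperplanes at [p], so they coincide; both
   functionals being normalized at [g], they are equal.  Hence [y] is the vector
   of monomials of [x] and [M(y) = [x^d][x^d]^T] has rank 1. *)
Require Import Defs.
From HB Require Import structures.
From mathcomp Require Import all_boot all_order all_algebra all_fingroup.
From mathcomp Require Import mpoly.
From mathcomp Require Import boolp classical_sets reals topology normedtype.

Set Implicit Arguments.
Unset Strict Implicit.
Unset Printing Implicit Defensive.

Import Order.TTheory GRing.Theory Num.Theory.
Import numFieldNormedType.Exports.

Local Open Scope classical_set_scope.
Local Open Scope ring_scope.

(** * Degrees of the squares in a homogeneous sum of squares *)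

Section SumsOfSquares.
Variables (R : realDomainType) (n : nat).
Implicit Types (q : {mpoly R[n]}) (qs : seq {mpoly R[n]}).

Lemma exists_max_mlead q0 qs : exists2 q, q \in q0 :: qs &
  {in q0 :: qs, forall r, (mlead r <= mlead q)%O}.
Proof.
elim: qs => [|q1 qs [q q_in maxq]].
  by exists q0; rewrite ?mem_head // => r /[!inE] /eqP ->.
have sub r : r \in [:: q0, q1 & qs] = (r == q1) || (r \in q0 :: qs).
  by rewrite !inE orbCA.
case: (leP (mlead q1) (mlead q)) => [le_q1|/ltW le_q].
  exists q; first by rewrite sub q_in orbT.
  by move=> r; rewrite sub => /predU1P [-> //|/maxq].
exists q1; first by rewrite sub eqxx.
by move=> r; rewrite sub => /predU1P [-> //|/maxq le_r]; apply: le_trans le_q.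
Qed.

(* The square of the largest leading monomial [a] has coefficient
   [\sum q@_a ^+ 2 > 0] in the sum of squares: it cannot cancel. *)
Lemma dhomog_sum_sqr_mdeg d qs :
  \sum_(q <- qs) q ^+ 2 \is (2 * d).-homog ->
  {in qs, forall q, {in msupp q, forall a, mdeg a <= d}%N}.
Proof.
case: qs => [//|q0 qs /dhomogP hom_p q q_in a a_q].
have [r r_in maxr] := exists_max_mlead q0 qs.
have le_a : (mdeg a <= mdeg (mlead r))%N.
  by apply: lemc_mdeg; apply: le_trans (maxr q q_in); apply: msupp_le_mlead.
apply: (leq_trans le_a).
have [->|r_neq0] := eqVneq r 0; first by rewrite mlead0 mdeg0.
have supp : (mlead r + mlead r)%MM \in msupp (\sum_(q <- q0 :: qs) q ^+ 2).
  rewrite mcoeff_msupp raddf_sum /= big_seq.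
  (* Only [mlead p <= mlead r] is used here: when it is strict, both sides are 0. *)
  rewrite (eq_bigr (fun p => p@_(mlead r) ^+ 2)); last first.
    by move=> p p_in; rewrite !expr2 mleadcMW //; apply: maxr.
  rewrite -big_seq.
  rewrite psumr_eq0; last by move=> p _; exact: sqr_ge0.
  apply/allPn; exists r; first exact: r_in.
  by rewrite /= sqrf_eq0 mleadc_eq0.
have /eqP : mdeg (mlead r + mlead r)%MM = (2 * d)%N := hom_p _ supp.
by rewrite mdegD addnn -mul2n eqn_pmul2l // => /eqP ->.
Qed.

End SumsOfSquares.

(** * The linear functional of a moment vector *)

Section Riesz.
Variables (R : realType) (n : nat).

(** The pairing with [y], extended to all polynomials by ignoring coefficients outside degree [m];
    the squared polynomials need not be homogeneous. On forms it is convertible to [pairing]. *)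
Definition riesz m (y : expo n m -> R) (p : {mpoly R[n]}) : R :=
  \sum_(a : expo n m) p@_a * y a.

Lemma riesz_is_linear m (y : expo n m -> R) : scalar (riesz y).
Proof.
move=> c p q; rewrite /riesz /= mulr_sumr -big_split; apply: eq_bigr => a _ /=.
by rewrite mcoeffD mcoeffZ mulrDl mulrA.
Qed.

HB.instance Definition _ m (y : expo n m -> R) :=
  GRing.isLinear.Build R {mpoly R[n]} R *%R (riesz y) (riesz_is_linear y).

Lemma rieszX m (y : expo n m -> R) (b : 'X_{1..n}) (a : expo n m) :
  b = a -> riesz y 'X_[b] = y a.
Proof.
move=> ->; rewrite /riesz (bigD1 a) //= big1 ?addr0 => [|c ne_ca].
  by rewrite mcoeffX eqxx mul1r.
rewrite mcoeffX; case: eqP => [ac|]; last by rewrite mul0r.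
by case/eqP: ne_ca; apply/val_inj/val_inj.
Qed.

Lemma mdeg_mon_expoD d (i j : 'I_#|{: expo n d}|) :
  mdeg (mon_expo i + mon_expo j)%MM = (2 * d)%N.
Proof. by rewrite mdegD !mdeg_mon_expo mul2n addnn. Qed.

Lemma moment_mx_riesz d (y : expo n (2 * d) -> R) i j :
  moment_mx y i j = riesz y 'X_[mon_expo i + mon_expo j].
Proof.
have dij := mdeg_mon_expoD i j.
have lt_ij : (mdeg (mon_expo i + mon_expo j)%MM < (2 * d).+1)%N by rewrite dij.
have eij : mdeg (BMultinom lt_ij) == (2 * d)%N by rewrite /= dij.
by rewrite (@moment_mxE _ _ _ _ _ _ (Expo eij)) // (@rieszX _ _ _ (Expo eij)).
Qed.

(** Only the degree-[d] part [h] of [q] matters: q^2 - h^2 = (q + h)(q - h) has degree below 2d,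
    where [riesz y] vanishes, and h^2 expands into the quadratic form of M(y). *)
Lemma riesz_sqr d (y : expo n (2 * d) -> R) (q : {mpoly R[n]}) :
  {in msupp q, forall a, mdeg a <= d}%N ->
  let v := \col_i q@_(mon_expo i) in
  riesz y (q ^+ 2) = (v^T *m moment_mx y *m v) 0 0.
Proof.
move=> le_q v.
pose h : {mpoly R[n]} := \sum_i q@_(@mon_expo n d i) *: 'X_[mon_expo i].
have hE a : mdeg a = d -> h@_a = q@_a.
  move=> da; rewrite /h raddf_sum /=.
  rewrite -(sum_expo_eq (fun b => q@_b) da).
  rewrite (reindex (fun i : 'I_#|{: expo n d}| => enum_val i)) /=; last first.
    by apply: onW_bij; apply: enum_val_bij.
  apply: eq_bigr => i _; rewrite mcoeffZ mcoeffX mulr_natr.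
  by rewrite eq_sym.
have h_homog a : a \in msupp h -> mdeg a = d.
  apply/dhomogP; apply: rpred_sum => i _; apply: rpredZ.
  by rewrite dhomogX; apply/eqP; apply: mdeg_mon_expo.
have lower a : a \in msupp (q - h) -> (mdeg a < d)%N.
  move=> a_in; rewrite ltn_neqAle; apply/andP; split.
    apply: contraTneq a_in => /hE ha.
    by rewrite mcoeff_msupp negbK mcoeffB ha subrr.
  by move/msuppB_le: a_in; rewrite mem_cat => /orP[/le_q|/h_homog ->].
have -> : q ^+ 2 = h ^+ 2 + (q + h) * (q - h).
  by rewrite [_ * (q - h)]mulrC -subr_sqr addrC subrK.
rewrite raddfD /= [X in _ + X]big1 ?addr0; last first.
  move=> a _; rewrite memN_msupp_eq0 ?mul0r //; apply/negP.
  move/msuppM_le/allpairsP => [[b c] /= [b_in c_in ab]].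
  have: (mdeg a < 2 * d)%N.
    rewrite ab mdegD mul2n -addnn -addnS leq_add ?lower //.
    by move/msuppD_le: b_in; rewrite mem_cat => /orP[/le_q|/h_homog ->].
  by rewrite expo_mdeg ltnn.
rewrite expr2 /h mulr_suml raddf_sum /= mxE.
under eq_bigr => i _ do rewrite mulr_sumr raddf_sum /=.
rewrite exchange_big /=; apply: eq_bigr => j _.
rewrite mxE mulr_suml; apply: eq_bigr => i _.
rewrite -scalerAl -scalerAr -mpolyXD !linearZ /= -moment_mx_riesz !mxE.
by rewrite mulrCA mulrC -mulrA mulrC.
Qed.

End Riesz.

(** * Functionals supporting the cone at a smooth point, and rank one *)

Section SmoothPoint.
Variables (R : realType) (n d : nat).
Implicit Types (p : dhomog n R (2 * d)) (l : {scalar dhomog n R (2 * d)}).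

Lemma kernel_supporting_hyperplane (S : set (dhomog n R (2 * d))) p g l :
  (forall s, S s -> 0 <= l s) -> l p = 0 -> l g = 1 ->
  supporting_hyperplane S p [set v | l v = 0].
Proof.
by move=> l_ge0 lp lg; exists l, 0; split => //; exists g; rewrite lg oner_neq0.
Qed.

Lemma smooth_point_sos_unique p g l1 l2 :
  smooth_point_sos p ->
  (forall s, sos_cone s -> 0 <= l1 s) -> l1 p = 0 -> l1 g = 1 ->
  (forall s, sos_cone s -> 0 <= l2 s) -> l2 p = 0 -> l2 g = 1 ->
  l1 =1 l2.
Proof.
move=> [_ [H [_ uniqH]]] l1_ge0 l1p l1g l2_ge0 l2p l2g q.
have H1 := uniqH _ (kernel_supporting_hyperplane l1_ge0 l1p l1g).
have H2 := uniqH _ (kernel_supporting_hyperplane l2_ge0 l2p l2g).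
(* This vector lies in the kernel of [l1], hence in that of [l2]; as [l2 g = 1], this reads
   [l2 q = l1 q]. *)
have : [set v | l1 v = 0] (q - l1 q *: g).
  by rewrite /= linearB linearZ /= l1g mulr1 subrr.
rewrite -H1 H2 /= linearB linearZ /= l2g mulr1.
by move/eqP; rewrite subr_eq0 => /eqP.
Qed.

Lemma meval_sos_ge0 (x : 'I_n -> R) p : sos_cone p -> 0 <= (val p).@[x].
Proof.
move=> [qs ->]; rewrite raddf_sum /= sumr_ge0 // => q _.
by rewrite rmorphXn sqr_ge0.
Qed.

(** Homogeneity of [p] bounds the degree of each [q] by [d], so each square is sent to a value of
    the quadratic form of M(y). *)
Lemma riesz_sos_ge0 (y : expo n (2 * d) -> R) p :
  psdmx (moment_mx y) -> sos_cone p -> 0 <= riesz y (val p).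
Proof.
move=> [_ psd] [qs p_qs]; rewrite p_qs raddf_sum /= big_seq.
apply: sumr_ge0 => q q_in; rewrite riesz_sqr //.
apply: dhomog_sum_sqr_mdeg q_in.
by rewrite -p_qs; apply: dhomog_is_dhomog.
Qed.

Lemma meval_gform (x : 'I_n -> R) : enorm x = 1 -> (val (gform R n d)).@[x] = 1.
Proof.
move=> x1; rewrite /= rmorphXn raddf_sum /=.
under eq_bigr do rewrite rmorphXn /= mevalXU.
have -> : \sum_(i < n) x i ^+ 2 = 1.
  rewrite -[LHS]sqr_sqrtr ?sumr_ge0 // => [|i _]; last exact: sqr_ge0.
  by rewrite -/(enorm x) x1 expr1n.
by rewrite expr1n.
Qed.

Lemma rank_moment_mx_eval (x : 'I_n -> R) (y : expo n (2 * d) -> R) :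
  enorm x = 1 ->
  (forall p, riesz y (val p) = (val p).@[x]) ->
  \rank (moment_mx y) = 1%N.
Proof.
move=> x1 y_eval.
pose v : 'cV[R]_#|{: expo n d}| := \col_i ('X_[mon_expo i] : {mpoly R[n]}).@[x].
have -> : moment_mx y = v *m v^T.
  apply/matrixP => i j; rewrite moment_mx_riesz !mxE big_ord1 !mxE -mevalM.
  have hX : ('X_[mon_expo i + mon_expo j] : {mpoly R[n]}) \is (2 * d).-homog.
    by rewrite dhomogX; apply/eqP; apply: mdeg_mon_expoD.
  by rewrite -mpolyXD (y_eval (DHomog hX)).
apply/eqP; rewrite eqn_leq; apply/andP; split.
  by rewrite (leq_trans (mulmx_max_rank _ _)).
rewrite lt0n mxrank_eq0; apply/eqP => vv0.
have [i xi_neq0] : exists i, x i != 0.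
  case: (pickP (fun i => x i != 0)) => [i xi|x0]; first by exists i.
  have : enorm x = 0.
    rewrite /enorm big1 ?sqrtr0 // => i _.
    by move: (x0 i) => /= /negbFE /eqP ->; rewrite expr0n.
  by move/eqP; rewrite x1 oner_eq0.
(* The diagonal entry of v v^T at the monomial x_i^d is (x_i^d)^2, which is nonzero. *)
have degi : mdeg (U_(i) *+ d)%MM = d by rewrite mdegMn mdeg1 mul1n.
have lti : (mdeg (U_(i) *+ d)%MM < d.+1)%N by rewrite degi.
have ei : mdeg (BMultinom lti) == d by rewrite /= degi.
have /matrixP/(_ (enum_rank (Expo ei)) (enum_rank (Expo ei))) := vv0.
rewrite !mxE big_ord1 !mxE /mon_expo enum_rankK /= -mpolyXn rmorphXn /= mevalXU.
by move/eqP; rewrite mulf_eq0 orbb expf_eq0 (negbTE xi_neq0) andbF.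
Qed.

Lemma rank_moment_mx_smooth p (x : 'I_n -> R) (y : expo n (2 * d) -> R) :
  smooth_point_sos p -> enorm x = 1 -> (val p).@[x] = 0 ->
  sdp_feasible y -> pairing p y = 0 -> \rank (moment_mx y) = 1%N.
Proof.
move=> smooth_p x1 px [psd_y gy] py.
apply: (rank_moment_mx_eval x1).
apply: (@smooth_point_sos_unique p (gform R n d)
  (riesz y \o @mpoly_of_dhomog n R (2 * d))
  (meval x \o @mpoly_of_dhomog n R (2 * d))) => //.
- by move=> s; apply: riesz_sos_ge0.
- by move=> s; apply: meval_sos_ge0.
- exact: meval_gform.
Qed.

End SmoothPoint.

(** * Application to the two semidefinite programs *)

Lemma pairingB (R : realType) n m (p q : dhomog n R m) y :
  pairing (p - q) y = pairing p y - pairing q y.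
Proof. exact: (raddfB (riesz y \o @mpoly_of_dhomog n R m)). Qed.

Lemma pairingZ (R : realType) n m c (p : dhomog n R m) y :
  pairing (c *: p) y = c * pairing p y.
Proof. exact: (scalarZ (riesz y \o @mpoly_of_dhomog n R m)). Qed.

Theorem theorem2p2 (R : realType) (n d : nat) (n_gt0 : (0 < n)%N)
    (d_gt0 : (0 < d)%N) (F : (2 * d).-tuple 'I_n -> R) (symF : sym_tensor F) :
  (forall (fmax fmax_sdp : R) (y : expo n (2 * d) -> R),
     is_max [set (val (tensor_form F)).@[x] | x in @sphere R n] fmax ->
     is_max [set pairing (tensor_form F) w | w in @sdp_feasible R n d]
       fmax_sdp ->
     maximizer (@sdp_feasible R n d) (pairing (tensor_form F)) y ->
     fmax = fmax_sdp ->
     smooth_point_sos (fmax *: gform R n d - tensor_form F) ->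
     \rank (moment_mx y) = 1%N) /\
  (forall (fmin fmin_sdp : R) (z : expo n (2 * d) -> R),
     is_min [set (val (tensor_form F)).@[x] | x in @sphere R n] fmin ->
     is_min [set pairing (tensor_form F) w | w in @sdp_feasible R n d]
       fmin_sdp ->
     minimizer (@sdp_feasible R n d) (pairing (tensor_form F)) z ->
     fmin = fmin_sdp ->
     smooth_point_sos (tensor_form F - fmin *: gform R n d) ->
     \rank (moment_mx z) = 1%N).
Proof.
split=> [fmax fsdp y|fmin fsdp z].
  move=> [[x x1 fx] _] [[w w_in fw] ub] [y_in y_max] eq_f smooth.
  have fy : pairing (tensor_form F) y = fmax.
    (* The SDP optimum bounds the value at [y] from above; it is attained at [w], which [y]
       dominates. *)
    apply/eqP; rewrite eq_le {1}eq_f ub /=; last by exists y.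
    by rewrite eq_f -fw y_max.
  (* Evaluation at [x] and pairing with [y] both send f to [fmax] and g to 1, so both vanish at
     [fmax] g - f. *)
  apply: (rank_moment_mx_smooth smooth x1 _ y_in).
    by rewrite /= mevalB mevalZ meval_gform // fx mulr1 subrr.
  by case: y_in => _ gy; rewrite pairingB pairingZ gy fy mulr1 subrr.
(* The same argument with inequalities reversed, for f - [fmin] g. *)
move=> [[x x1 fx] _] [[w w_in fw] lb] [z_in z_min] eq_f smooth.
have fz : pairing (tensor_form F) z = fmin.
  apply/eqP; rewrite eq_le {2}eq_f lb /= ?andbT; last by exists z.
  by rewrite eq_f -fw z_min.
apply: (rank_moment_mx_smooth smooth x1 _ z_in).
  by rewrite /= mevalB mevalZ meval_gform // fx mulr1 subrr.
by case: z_in => _ gz; rewrite pairingB pairingZ gz fz mulr1 subrr.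
Qed.
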